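(* Let $\mathcal S,\mathcal A,\mathcal W$ be finite sets, $f:\mathcal S\times\mathcal A\times\mathcal W\to\mathcal S$, $r:\mathcal S\times\mathcal A\times\mathcal W\to\mathbb R$ with $|r|\le R_{\max}<\infty$, let $k\ge1$ and $T\ge k$ be integers, and let $s_0\in\mathcal S$. Let $\mathrm{Reg}_{T,k}^\star(s_0)$ be the optimal finite-horizon worst-case regret against $k$-lookahead policies, and let $\Psi_k$, $J_t$ ($k\le t\le T$) and $G_h$ ($0\le h\le k$) be the tail value, regret dynamic program and prefix dynamic program defined in the context. Then these backward dynamic programs are well-defined, and an optimal regret-minimizing policy (a causal policy attaining the infimum defining $\mathrm{Reg}_{T,k}^\star(s_0)$) is any selector that chooses, for $k\le t<T$, the action $a_t=a_t^\star(x_t)$ with $x_t=(s_t^{C},s_{t-k}^{L},w_{t-k}^{t-1})$ and $$a_t^\star(x)\in\arg\min_{a^{C}\in\mathcal A}\ \max_{w\in\mathcal W,\ a^{L}\in\mathcal A}\Big\{\rho(x,a^{C},a^{L},w)+J_{t+1}(x^+)\Big\},\qquad x^+=F(x,a^{C},a^{L},w),$$ and, for $0\le t<k$, the action $a_t=a_t^\star(s_t^{C},w_0^{t-1})$ with $$a_t^\star(s^{C},w_0^{t-1})\in\arg\min_{a^{C}\in\mathcal A}\ \max_{w\in\mathcal W}\Big\{-r(s^{C},a^{C},w)+G_{t+1}\big(f(s^{C},a^{C},w),\,w_0^{t-1}\#w\big)\Big\}.$$ Moreover, the optimal regret is $$\mathrm{Reg}_{T,k}^\star(s_0)=G_0(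s_0).$$
   Context: Notation: $w_i^j:=(w_i,\dots,w_j)$ for $i\le j$ (and the empty tuple if $j=i-1$); $v\#w$ is the tuple $v$ with the scalar $w$ appended at the end. Superscripts $C$ and $L$ refer to the causal controller and to the lookahead benchmark. System: starting from $s_0$, $s_{t+1}=f(s_t,a_t,w_t)$, $0\le t<T$, with reward $r_t=r(s_t,a_t,w_t)$. Policies: a (history-dependent) $k$-lookahead policy is a sequence of deterministic decision rules in which $a_t=\mu_t^k(s_0,w_0^{t+k-1})$ is a function of $s_0$ and $w_0,\dots,w_{t+k-1}$ (on the horizon $T$, only the disturbances with index at most $T-1$ exist, so for $t+k-1\ge T$ the rule sees $w_0^{T-1}$); the class of these is $\Pi_k$. Causal policies are $\Pi_C:=\Pi_0$, i.e. $a_t=\mu_t(s_0,w_0^{t-1})$. Return: $V_T(s_0,\pi;w_0^{T-1})=\sum_{t=0}^{T-1}r_t$ along the trajectory generated by $\pi$ and $w_0^{T-1}$ from $s_0$. Regret: for $\pi_C\in\Pi_C$ and a benchmark policy $\pi_L$, $$\mathrm{Regret}_T(s_0,\pi_C,\pi_L):=\sup_{w_0^{T-1}\in\mathcal W^T}\big(V_T(s_0,\pi_L;w_0^{T-1})-V_T(s_0,\pi_C;w_0^{T-1})\big),$$ $$\mathrm{Reg}_{T,k}^\star(s_0):=\inf_{\pi_C\in\Pi_C}\ \sup_{\pi_L\in\Pi_k}\mathrm{Regret}_T(s_0,\pi_C,\pi_L).$$ Tracking state space: $\mathcal X:=\mathcal S\times\mathcal S\times\mathcal W^k$, with elements $x=(s^{C},s^{L},w_0^{k-1})$.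 At time $t\ge k$ the tracking state is $x_t=(s_t^{C},s_{t-k}^{L},w_{t-k}^{t-1})$, where $s_t^{C}$ is the state of the causal controller at time $t$ and $s_{t-k}^{L}$ is the state of the benchmark at time $t-k$, both trajectories starting from $s_0$ and driven by the same disturbance sequence; in particular $x_k=(s_k^{C},s_0,w_0^{k-1})$. The transition function is $$x^+=F(x,a^{C},a^{L},w):=\big(f(s^{C},a^{C},w),\ f(s^{L},a^{L},w_0),\ w_1^{k-1}\#w\big),$$ and the aligned regret (with discount factor $1$) is $$\rho(x,a^{C},a^{L},w):=r(s^{L},a^{L},w_0)-r(s^{C},a^{C},w).$$ Tail value: $\Psi_k:\mathcal S\times\mathcal W^k\to\mathbb R$, $$\Psi_k(s^{L},w_0^{k-1}):=\sup_{\pi_L\in\Pi_k}\ \sum_{\tau=T-k}^{T-1}r(s_\tau^{L},a_\tau^{L},w_\tau),$$ where the benchmark starts at time $T-k$ in state $s_{T-k}^{L}=s^{L}$ and the last $k$ disturbances $w_{T-k}^{T-1}$ are equal to the given block $w_0^{k-1}$. Regret DP: $J_T(x):=\Psi_k(s^{L},w_0^{k-1})$ for $x=(s^{C},s^{L},w_0^{k-1})\in\mathcal X$, and for $k\le t<T$ $$J_t(x)=\min_{a^{C}\in\mathcal A}\ \max_{w\in\mathcal W,\ a^{L}\in\mathcal A}\big\{\rho(x,a^{C},a^{L},w)+J_{t+1}(x^+)\big\},\qquad x^+=F(x,a^{C},a^{L},w).$$ Prefix DP: $G_h:\mathcal S\times\mathcal W^h\to\mathbb R$, defined (for the given $s_0$)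 by $G_k(s,w_0^{k-1}):=J_k\big((s,s_0,w_0^{k-1})\big)$ and, for $0\le h<k$, $$G_h(s,w_0^{h-1})=\min_{a^{C}\in\mathcal A}\ \max_{w\in\mathcal W}\big\{-r(s,a^{C},w)+G_{h+1}\big(f(s,a^{C},w),\,w_0^{h-1}\#w\big)\big\}.$$
   Formalization: The infimum defining Reg* ranges over causal rules that also see the delayed benchmark states s_0^L,...,s_{t-k}^L, as the stated selector does; over Pi_0 (functions of s_0 and w_0^{t-1} only) the equality with G_0(s_0) can fail. A and W are assumed nonempty. *)

(* Defs.v *)
From mathcomp Require Import all_boot all_order all_algebra.
From mathcomp Require Import all_classical all_reals.

Set Implicit Arguments.
Unset Strict Implicit.
Unset Printing Implicit Defensive.

Import Order.TTheory GRing.Theory Num.Theory.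
Local Open Scope classical_set_scope.
Local Open Scope ring_scope.

Definition is_min (R : realType) (I : Type) (F : I -> R) (m : R) : Prop :=
  (exists i, F i = m) /\ (forall i, m <= F i).

Definition is_max (R : realType) (I : Type) (F : I -> R) (m : R) : Prop :=
  (exists i, F i = m) /\ (forall i, F i <= m).

Definition argmin (R : realType) (I : Type) (F : I -> R) (i : I) : Prop :=
  forall j, F i <= F j.

(* The class Pi_k.  The rule is never applied to the whole disturbance sequence:
   [action] below feeds it [take (t + k) w], i.e. w_0, ..., w_{t+k-1}, cut off
   at the end of [w]. *)
Record policy (S A W : Type) (k : nat) :=
  Policy { rule :> nat -> S -> seq W -> A }.

(* Decision rules a_t = c t s_0 (w_0, ..., w_{t-1}) (s^L_0, ..., s^L_{t-k}) that
   also read the benchmark states contained in the tracking states up to time t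
   (no benchmark state for t < k).  Since s^L_{t-k} only depends on s_0 and
   w_0, ..., w_{t-2}, such a rule is a member of Pi_0 against each benchmark,
   see [against]. *)
Record controller (S A W : Type) :=
  Controller { crule :> nat -> S -> seq W -> seq S -> A }.

Section Game.
Context {R : realType} {S A W : finType}.
Context (f : S -> A -> W -> S) (r : S -> A -> W -> R).

(* State reached from [s] at time [t] after the disturbances [w], the action
   at time i in state s' being [mu i s']. *)
Fixpoint run (mu : nat -> S -> A) (t : nat) (s : S) (w : seq W) : S :=
  if w is x :: w' then run mu t.+1 (f s (mu t s) x) w' else s.

Definition action k (pi : policy S A W k) (s0 : S) (w : seq W) (t : nat) : A :=
  pi t s0 (take (t + k) w).

Definition state_at k (pi : policy S A W k) (s0 : S) (w : seq W) (t : nat) : S :=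
  run (fun i _ => action pi s0 w i) 0 s0 (take t w).

Definition total_reward T k (pi : policy S A W k) (s0 : S) (w : T.-tuple W) : R :=
  \sum_(t < T) r (state_at pi s0 w t) (action pi s0 w t) (tnth w t).

Definition regret T k (s0 : S) (piC : policy S A W 0) (piL : policy S A W k) : R :=
  sup (range (fun w : T.-tuple W =>
    total_reward piL s0 w - total_reward piC s0 w)).

(* The causal policy obtained by running [c] alongside the benchmark [piL]. *)
Definition against k (c : controller S A W) (piL : policy S A W k) :
    policy S A W 0 :=
  Policy 0 (fun t s0 v =>
    c t s0 v [seq state_at piL s0 v j | j <- iota 0 (t.+1 - k)]).

Definition worst_regret T k (s0 : S) (c : controller S A W) : R :=
  sup (range (fun piL : policy S A W k => regret T s0 (against c piL) piL)).

(* The infimum must range over rules that may read the delayed benchmark state: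
   the minimizing selectors read it, and the infimum over rules of
   (s_0, w_0, ..., w_{t-1}) alone can be strictly larger than the value of the
   dynamic program. *)
Definition opt_regret T k (s0 : S) : R :=
  inf (range (worst_regret T k s0)).

(* The sum over tau = T-k, ..., T-1 for the benchmark started in [sL] at time
   T-k; its rules still see [s0] and all of [w]. *)
Definition tail_reward T k (s0 : S) (piL : policy S A W k) (sL : S)
    (w : T.-tuple W) : R :=
  \sum_(t < T | (T - k <= t)%N)
     r (run (fun i _ => action piL s0 w i) (T - k) sL
            (take (t - (T - k)) (drop (T - k) w)))
       (action piL s0 w t) (tnth w t).

(* The past seen by the rules (s_0 and w_0, ..., w_{T-k-1}) is left free in the
   supremum; the value does not depend on it. *)
Definition Psi T k (sL : S) (b : seq W) : R :=
  sup [set v | exists (s0 : S) (w : T.-tuple W) (piL : policy S A W k),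
         drop (T - k) w = b /\ v = tail_reward s0 piL sL w].

(* Elements (s^C, s^L, b) of the tracking space have [size b = k]. *)
Definition tracking : Type := (S * S * seq W)%type.

(* [head w b] is w_0, as b is nonempty; [behead (rcons b w)] is w_1^{k-1}#w. *)
Definition F (x : tracking) (aC aL : A) (w : W) : tracking :=
  let: (sC, sL, b) := x in
  (f sC aC w, f sL aL (head w b), behead (rcons b w)).

Definition rho (x : tracking) (aC aL : A) (w : W) : R :=
  let: (sC, sL, b) := x in r sL aL (head w b) - r sC aC w.

Definition backup (V : tracking -> R) (x : tracking) (aC : A) : R :=
  sup (range (fun p : W * A => rho x aC p.2 p.1 + V (F x aC p.2 p.1))).

Definition J T k (t : nat) : tracking -> R :=
  iter (T - t) (fun V x => inf (range (backup V x))) (fun x => Psi T k x.1.2 x.2).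

Definition prefix_backup (V : S -> seq W -> R) (s : S) (v : seq W) (aC : A) : R :=
  sup (range (fun w : W => - r s aC w + V (f s aC w) (rcons v w))).

Definition G T k (s0 : S) (h : nat) : S -> seq W -> R :=
  iter (k - h) (fun V s v => inf (range (prefix_backup V s v)))
       (fun s v => J T k k (s, s0, v)).

(* [selector_action k aJ aG v hL t s] is the action prescribed at time t in the
   controller state s by the stage selectors [aJ] (t >= k) and [aG] (t < k), for
   the disturbances [v] and the benchmark states [hL]. *)
Definition selector_action k (aJ : nat -> tracking -> A)
    (aG : nat -> S -> seq W -> A) (v : seq W) (hL : seq S) (t : nat) (s : S) : A :=
  if (t < k)%N then aG t s (take t v)
  else aJ t (s, nth s hL (t - k), drop (t - k) (take t v)).

(* The controller state s^C_t is recomputed by replaying the selector. *)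
Definition selector k (aJ : nat -> tracking -> A) (aG : nat -> S -> seq W -> A) :
    controller S A W :=
  Controller (fun t s0 v hL =>
    let mu := selector_action k aJ aG v hL in mu t (run mu 0 s0 v)).

End Game.

(* Main.v *)
(* Fix the action sequences of the controller and of the benchmark and the
   disturbances.  Delaying the benchmark by k steps, the regret is the sum of the
   stage gains r(s^L_{t-k}, a^L_{t-k}, w_{t-k}) - r(s^C_t, a^C_t, w_t), without
   the first term for t < k, plus the benchmark's reward over the last k steps,
   which is at most Psi.  A minimizing selector keeps the accumulated gain plus
   the value of the dynamic program nonincreasing along every trajectory, so its
   regret never exceeds G_0.  Conversely, against any deterministic controller,
   an adversary playing maximizing pairs (w_t, a^L_{t-k}) keeps that quantity
   nondecreasing; its choices can be computed in advance, hence are realized by an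
   open-loop benchmark, and the regret is at least G_0. *)
Require Import Defs.
From mathcomp Require Import all_boot all_order all_algebra.
From mathcomp Require Import all_classical all_reals.

Set Implicit Arguments.
Unset Strict Implicit.
Unset Printing Implicit Defensive.

Import Order.TTheory GRing.Theory Num.Theory.
Local Open Scope classical_set_scope.
Local Open Scope ring_scope.

(** * Suprema and infima that are attained *)

Section Extrema.
Context {R : realType}.

Lemma is_max_sup (I : Type) (F : I -> R) (m : R) :
  is_max F m -> sup (range F) = m.
Proof.
move=> [[i Fi] Fm]; apply/eqP; rewrite eq_le; apply/andP; split.
  by apply: ge_sup => [|_ [j _ <-]]; [exists (F i), i | apply: Fm].
by apply: ub_le_sup; [exists m => _ [j _ <-]; apply: Fm | exists i].
Qed.

Lemma is_min_inf (I : Type) (F : I -> R) (m : R) :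
  is_min F m -> inf (range F) = m.
Proof.
move=> [[i Fi] Fm]; apply/eqP; rewrite eq_le; apply/andP; split.
  by apply: ge_inf; [exists m => _ [j _ <-]; apply: Fm | exists i].
by apply: lb_le_inf => [|_ [j _ <-]]; [exists (F i), i | apply: Fm].
Qed.

Lemma sup_is_max (I : finType) (F : I -> R) :
  (0 < #|I|)%N -> is_max F (sup (range F)).
Proof.
move=> /card_gt0P[i0 _].
have Fmax : is_max F (F [arg max_(i > i0) F i]%O).
  case: Order.TotalTheory.arg_maxP => // i _ Fi.
  by split=> [|j]; [exists i | apply: Fi].
by rewrite (is_max_sup Fmax).
Qed.

Lemma inf_is_min (I : finType) (F : I -> R) :
  (0 < #|I|)%N -> is_min F (inf (range F)).
Proof.
move=> /card_gt0P[i0 _].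
have Fmin : is_min F (F [arg min_(i < i0) F i]%O).
  case: Order.TotalTheory.arg_minP => // i _ Fi.
  by split=> [|j]; [exists i | apply: Fi].
by rewrite (is_min_inf Fmin).
Qed.

End Extrema.

(** * Prefixes of sequences and the trajectories they drive *)

Lemma take_mkseq (T : Type) (g : nat -> T) (m n : nat) :
  (m <= n)%N -> take m (mkseq g n) = mkseq g m.
Proof. by move=> le_mn; rewrite /mkseq -map_take take_iota (minn_idPl le_mn). Qed.

Lemma mkseq_prefix (T : Type) (w : T) (s : seq T) (n : nat) :
  (n <= size s)%N -> mkseq (nth w s) n = take n s.
Proof. exact: map_nth_iota0. Qed.

Section Trajectories.
Context {S A W : finType} (f : S -> A -> W -> S).

Lemma run_cat (mu : nat -> S -> A) t s (v w : seq W) :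
  run f mu t s (v ++ w) = run f mu (t + size v) (run f mu t s v) w.
Proof.
by elim: v t s => [|x v IH] t s; rewrite /= ?addn0 // IH addnS.
Qed.

Lemma run_rcons (mu : nat -> S -> A) t s (v : seq W) x :
  run f mu t s (rcons v x)
  = f (run f mu t s v) (mu (t + size v)%N (run f mu t s v)) x.
Proof. by rewrite -cats1 run_cat. Qed.

Lemma eq_run (mu nu : nat -> S -> A) t s (w : seq W) :
  (forall i s', (t <= i < t + size w)%N -> mu i s' = nu i s') ->
  run f mu t s w = run f nu t s w.
Proof.
elim: w t s => [//|x w IH] t s eq_mu /=.
rewrite eq_mu ?leqnn ?addnS ?ltnS ?leq_addr //.
apply: IH => i s' /andP[lt_ti lt_i]; apply: eq_mu.
by rewrite (ltnW lt_ti) addnS -addSn.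
Qed.

Definition traj (s0 : S) (a : nat -> A) (w : nat -> W) (n : nat) : S :=
  run f (fun i _ => a i) 0 s0 (mkseq w n).

Lemma trajS s0 a w n :
  traj s0 a w n.+1 = f (traj s0 a w n) (a n) (w n).
Proof. by rewrite /traj mkseqS run_rcons size_mkseq. Qed.

Lemma eq_traj s0 a a' w w' n :
  (forall i, (i < n)%N -> a i = a' i) -> (forall i, (i < n)%N -> w i = w' i) ->
  traj s0 a w n = traj s0 a' w' n.
Proof.
elim: n => [//|n IH] eq_a eq_w; rewrite !trajS eq_a // eq_w //.
by rewrite IH // => i /ltnW lt_in; [apply: eq_a | apply: eq_w].
Qed.

Lemma state_atE k (pi : policy S A W k) s0 (w : seq W) w0 n :
  (n <= size w)%N ->
  state_at f pi s0 w n = traj s0 (action pi s0 w) (nth w0 w) n.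
Proof. by move=> le_n; rewrite /traj mkseq_prefix. Qed.

(** The actions before time [n] read no disturbance of index above [n + k - 2], so the first [m]
    disturbances already determine this state. *)
Lemma state_at_take k (pi : policy S A W k) s0 (w : seq W) (n m : nat) :
  (1 <= k)%N -> (n + k <= m.+1)%N ->
  state_at f pi s0 (take m w) n = state_at f pi s0 w n.
Proof.
move=> hk le_nm; have le_n : (n <= m)%N.
  by rewrite -ltnS (leq_trans _ le_nm) // -addn1 leq_add2l.
rewrite /state_at -take_min (minn_idPl le_n).
apply: eq_run => i _; rewrite add0n size_take_min => /andP[_].
rewrite ltn_min => /andP[lt_in _].
rewrite /action -take_min (minn_idPl _) //.
by rewrite -ltnS (leq_trans _ le_nm) // ltn_add2r.
Qed.

End Trajectories.

(** * The tail value *)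

Section Game.
Context {R : realType} {S A W : finType}.
Context (f : S -> A -> W -> S) (r : S -> A -> W -> R) (k T : nat) (s0 : S).
Context (a0 : A) (w0 : W) (hk : (1 <= k)%N) (hT : (k <= T)%N).

Definition tail_sum (a : nat -> A) (sL : S) (b : seq W) : R :=
  \sum_(t < T | (T - k <= t)%N)
    r (run f (fun i _ => a i) (T - k) sL (take (t - (T - k)) b)) (a t)
      (nth w0 b (t - (T - k))).

Lemma tail_rewardE (s : S) (piL : policy S A W k) sL (w : T.-tuple W) :
  tail_reward f r s piL sL w = tail_sum (action piL s w) sL (drop (T - k) w).
Proof.
apply: eq_bigr => t le_t.
by rewrite nth_drop subnKC // (tnth_nth w0).
Qed.

Lemma eq_tail_sum (a a' : nat -> A) sL b :
  (forall i, (T - k <= i < T)%N -> a i = a' i) ->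
  tail_sum a sL b = tail_sum a' sL b.
Proof.
move=> eq_a; apply: eq_bigr => t le_t; rewrite eq_a ?le_t //=.
congr (r _ _ _); apply: eq_run => i _ /andP[le_i lt_i].
apply: eq_a; rewrite le_i (leq_trans lt_i) // size_take_min.
apply: leq_trans (leq_add (leqnn _) (geq_minl _ _)) _.
by rewrite subnKC // ltnW.
Qed.

Definition open_loop (a : nat -> A) : policy S A W k := Policy k (fun t _ _ => a t).

(** For a fixed [w] a policy counts only through the [T] actions it plays, so finitely many tuples
    matter; an open-loop policy realizes the best one, whatever the past. *)
Lemma Psi_max (s : S) (w : T.-tuple W) (sL : S) :
  is_max (fun piL : policy S A W k => tail_reward f r s piL sL w)
         (Psi f r T k sL (drop (T - k) w)).
Proof.
set b := drop (T - k) w.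
pose D (g : T.-tuple A) := tail_sum (nth a0 g) sL b.
have [|[g Dg] Dmax] := @sup_is_max _ _ D.
  by apply/card_gt0P; exists [tuple of nseq T a0].
have bound s' (w' : T.-tuple W) (piL : policy S A W k) : drop (T - k) w' = b ->
    tail_reward f r s' piL sL w' <= sup (range D).
  move=> eq_b; rewrite tail_rewardE eq_b.
  apply: le_trans (Dmax [tuple of mkseq (action piL s' w') T]).
  rewrite le_eqVlt; apply/orP; left; apply/eqP/eq_tail_sum => i /andP[_ lt_i].
  by rewrite nth_mkseq.
have attained : tail_reward f r s (open_loop (nth a0 g)) sL w = sup (range D).
  by rewrite tail_rewardE -Dg.
suff -> : Psi f r T k sL b = sup (range D).
  by split=> [|piL]; [exists (open_loop (nth a0 g)) | apply: bound].
apply/eqP; rewrite eq_le; apply/andP; split.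
  apply: ge_sup => [|_ [s' [w' [piL [eq_b ->]]]]]; last exact: bound.
  by exists (sup (range D)), s, w, (open_loop (nth a0 g)).
apply: ub_le_sup.
  by exists (sup (range D)) => _ [s' [w' [piL [eq_b ->]]]]; apply: bound.
by exists s, w, (open_loop (nth a0 g)).
Qed.

Let cardA : (0 < #|A|)%N. Proof. by apply/card_gt0P; exists a0. Qed.
Let cardW : (0 < #|W|)%N. Proof. by apply/card_gt0P; exists w0. Qed.
Let cardWA : (0 < #|{: W * A}|)%N.
Proof. by apply/card_gt0P; exists (w0, a0). Qed.

(** * The two dynamic programs, unfolded and merged *)

Lemma JS t : (t < T)%N ->
  J f r T k t = fun x => inf (range (backup f r (J f r T k t.+1) x)).
Proof. by move=> lt_t; rewrite /J -(subnSK lt_t). Qed.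

Lemma GS h : (h < k)%N ->
  G f r T k s0 h
  = fun s v => inf (range (prefix_backup f r (G f r T k s0 h.+1) s v)).
Proof. by move=> lt_h; rewrite /G -(subnSK lt_h). Qed.

Lemma G_top s v : G f r T k s0 k s v = J f r T k k (s, s0, v).
Proof. by rewrite /G subnn. Qed.

Lemma J_top x : J f r T k T x = Psi f r T k x.1.2 x.2.
Proof. by rewrite /J subnn. Qed.

(* The two dynamic programs as a single one: for [t < k] the benchmark component
   of the tracking state is ignored and the block has length [t]. *)
Definition value (t : nat) (x : @tracking S W) : R :=
  if (t < k)%N then G f r T k s0 t x.1.1 x.2 else J f r T k t x.

Definition stage_backup (t : nat) (x : @tracking S W) : A -> R :=
  if (t < k)%N then prefix_backup f r (G f r T k s0 t.+1) x.1.1 x.2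
  else backup f r (J f r T k t.+1) x.

(** For [t < k] the action in [p] is ignored, which gives both phases the same moves [W * A]. *)
Definition stage (t : nat) (x : @tracking S W) (aC : A) (p : W * A) : R :=
  if (t < k)%N
  then - r x.1.1 aC p.1 + G f r T k s0 t.+1 (f x.1.1 aC p.1) (rcons x.2 p.1)
  else rho r x aC p.2 p.1 + J f r T k t.+1 (F f x aC p.2 p.1).

Lemma backup_max V x aC :
  is_max (fun p : W * A => rho r x aC p.2 p.1 + V (F f x aC p.2 p.1))
         (backup f r V x aC).
Proof. exact: sup_is_max. Qed.

Lemma prefix_backup_max V s v aC :
  is_max (fun w : W => - r s aC w + V (f s aC w) (rcons v w))
         (prefix_backup f r V s v aC).
Proof. exact: sup_is_max. Qed.

Lemma stage_backup_max t x aC : is_max (stage t x aC) (stage_backup t x aC).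
Proof.
rewrite /stage /stage_backup; case: ifP => _; last exact: backup_max.
have [[w Pw] Pmax] := prefix_backup_max (G f r T k s0 t.+1) x.1.1 x.2 aC.
by split=> [|p]; [exists (w, a0) | apply: Pmax].
Qed.

Lemma value_min t x : (t < T)%N -> is_min (stage_backup t x) (value t x).
Proof.
move=> lt_t; rewrite /value /stage_backup; case: ifP => [lt_k | _].
  by rewrite (GS lt_k); exact: (@inf_is_min R A).
by rewrite (JS lt_t); exact: (@inf_is_min R A).
Qed.

(* Tracking state at time [t], with benchmark state [s0] and block
   [w_0, ..., w_{t-1}] for [t < k]. *)
Definition track (aC aL : nat -> A) (w : nat -> W) (t : nat) : @tracking S W :=
  (traj f s0 aC w t, traj f s0 aL w (t - k), drop (t - k) (mkseq w t)).

Lemma size_track aC aL w t : size (track aC aL w t).2 = minn t k.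
Proof.
rewrite /track /= size_drop size_mkseq.
by case: (leqP k t) => [/subKn // | /ltnW]; rewrite /leq => /eqP ->; rewrite subn0.
Qed.

(** * Stage gains and telescoping of the value *)

Definition gain (aC aL : nat -> A) (w : nat -> W) (t : nat) : R :=
  (if (t < k)%N then 0
   else r (traj f s0 aL w (t - k)) (aL (t - k)%N) (w (t - k)%N))
  - r (traj f s0 aC w t) (aC t) (w t).

(** The update [F] follows the tracking states of the actual trajectories, and the benchmark state
    stays at [s0] up to time [k]. *)
Lemma stage_track aC aL w t :
  stage t (track aC aL w t) (aC t) (w t, aL (t - k)%N)
  = gain aC aL w t + value t.+1 (track aC aL w t.+1).
Proof.
rewrite /stage /gain /value /track /=; case: (ltnP t k) => [lt_t | le_t].
  have t0 : (t - k = 0)%N by apply/eqP/ltnW.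
  have t1 : (t.+1 - k = 0)%N by apply/eqP.
  rewrite t0 t1 !drop0 mkseqS trajS sub0r; congr (_ + _).
  (* Handover at [t.+1 = k]: the next value is [J], which agrees with [G] at the benchmark state
     [s0]. *)
  case: ltnP => // le_t; have -> : k = t.+1 by apply/eqP; rewrite eqn_leq le_t.
  by rewrite /G subnn /=.
rewrite ltnNge ltnW ?ltnS //=.
(* Since [1 <= k], the block is nonempty and the default of [head] is never returned. *)
have lt_tk : (t - k < t)%N by rewrite -subSn // leq_subLR -add1n leq_add2r.
have -> : head (w t) (drop (t - k) (mkseq w t)) = w (t - k)%N.
  by rewrite -nth0 nth_drop addn0 nth_mkseq.
by rewrite subSn // !trajS -drop_rcons ?size_mkseq ?leq_subr // -mkseqS
  -drop1 drop_drop add1n.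
Qed.

Lemma value0 aC aL w : value 0 (track aC aL w 0) = G f r T k s0 0 s0 [::].
Proof. by rewrite /value hk. Qed.

Lemma valueT x : value T x = Psi f r T k x.1.2 x.2.
Proof. by rewrite /value ltnNge hT J_top. Qed.

(** With a minimizing action, the stage payoff is at most the current value for every move of the
    adversary; the differences telescope. *)
Lemma value_ge aC aL w :
  (forall t, (t < T)%N -> argmin (stage_backup t (track aC aL w t)) (aC t)) ->
  \sum_(0 <= t < T) gain aC aL w t + value T (track aC aL w T)
  <= value 0 (track aC aL w 0).
Proof.
move=> opt; rewrite -lerBrDr.
rewrite -[leRHS]opprB -(telescope_sumr (fun t => value t (track aC aL w t)) (leq0n T)) -sumrN.
apply: ler_sum_nat => t /andP[_ lt_t].
rewrite opprB lerBrDr -stage_track.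
have [[a <-] _] := value_min (track aC aL w t) lt_t.
exact: le_trans ((stage_backup_max _ _ _).2 _) (opt t lt_t a).
Qed.

(** Dual bound: a maximizing move attains the backup of the chosen action, and no action has a
    backup below the value. *)
Lemma value_le aC aL w :
  (forall t, (t < T)%N ->
     stage t (track aC aL w t) (aC t) (w t, aL (t - k)%N)
     = stage_backup t (track aC aL w t) (aC t)) ->
  value 0 (track aC aL w 0)
  <= \sum_(0 <= t < T) gain aC aL w t + value T (track aC aL w T).
Proof.
move=> adv; rewrite -lerBlDr.
rewrite -[leLHS]opprB -(telescope_sumr (fun t => value t (track aC aL w t)) (leq0n T)) -sumrN.
apply: ler_sum_nat => t /andP[_ lt_t].
rewrite opprB lerBlDr -stage_track adv //.
exact: (value_min (track aC aL w t) lt_t).2.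
Qed.

(** * Regret as a sum of stage gains and a tail *)

Lemma sum_gain aC aL w :
  \sum_(0 <= t < T) gain aC aL w t
  = \sum_(0 <= t < T - k) r (traj f s0 aL w t) (aL t) (w t)
    - \sum_(0 <= t < T) r (traj f s0 aC w t) (aC t) (w t).
Proof.
rewrite sumrB; congr (_ - _).
rewrite (big_cat_nat (n := k)) //= big_nat big1 ?add0r; last first.
  by move=> t /andP[_ ->].
rewrite -{1}[k]add0n big_addn; apply: eq_bigr => t _.
by rewrite ltnNge leq_addl addnK.
Qed.

Lemma total_rewardE j (pi : policy S A W j) (w : T.-tuple W) :
  total_reward f r pi s0 w
  = \sum_(0 <= t < T) r (traj f s0 (action pi s0 w) (nth w0 w) t)
                        (action pi s0 w t) (nth w0 w t).
Proof.
rewrite big_mkord; apply: eq_bigr => t _.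
by rewrite (state_atE _ _ _ w0) ?size_tuple 1?ltnW // (tnth_nth w0).
Qed.

Lemma tail_reward_traj (piL : policy S A W k) (w : T.-tuple W) :
  tail_reward f r s0 piL (traj f s0 (action piL s0 w) (nth w0 w) (T - k)) w
  = \sum_(T - k <= t < T) r (traj f s0 (action piL s0 w) (nth w0 w) t)
                            (action piL s0 w t) (nth w0 w t).
Proof.
rewrite big_geq_mkord; apply: eq_bigr => t le_t.
rewrite (tnth_nth w0) /traj !mkseq_prefix ?size_tuple ?leq_subr 1?ltnW //.
congr (r _ _ _); rewrite -[in RHS](subnKC le_t) takeD run_cat add0n.
by rewrite size_takel // size_tuple leq_subr.
Qed.

Lemma regret_gain (piC : policy S A W 0) (piL : policy S A W k) (w : T.-tuple W) :
  total_reward f r piL s0 w - total_reward f r piC s0 w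
  = \sum_(0 <= t < T) gain (action piC s0 w) (action piL s0 w) (nth w0 w) t
    + tail_reward f r s0 piL (traj f s0 (action piL s0 w) (nth w0 w) (T - k)) w.
Proof.
rewrite sum_gain tail_reward_traj !total_rewardE addrAC; congr (_ - _).
by rewrite -big_cat_nat ?leq_subr.
Qed.

Lemma value_top aC aL (w : T.-tuple W) :
  value T (track aC aL (nth w0 w) T)
  = Psi f r T k (traj f s0 aL (nth w0 w) (T - k)) (drop (T - k) w).
Proof. by rewrite valueT /= mkseq_prefix ?size_tuple // take_oversize ?size_tuple. Qed.

(** * Controllers along fixed benchmark actions and disturbances *)

Definition response (c : controller S A W) (aL : nat -> A) (w : nat -> W)
    (t : nat) : A :=
  c t s0 (mkseq w t) (mkseq (traj f s0 aL w) (t.+1 - k)).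

Lemma lt_delay i t : (i < t.+1 - k)%N -> (i + k <= t)%N.
Proof. by rewrite ltn_subRL addnC. Qed.

(** [against] computes the benchmark states from the disturbances seen so far; thanks to the delay
    of [k] steps they are the true ones. *)
Lemma action_against (c : controller S A W) (piL : policy S A W k)
    (w : T.-tuple W) t : (t <= T)%N ->
  action (against f c piL) s0 w t
  = response c (action piL s0 w) (nth w0 w) t.
Proof.
move=> le_t; rewrite /action /= addn0 /response mkseq_prefix ?size_tuple //.
congr (c _ _ _ _); apply/eq_in_map => i; rewrite mem_iota add0n => /lt_delay le_i.
rewrite (state_at_take _ _ _ _ hk) ?(leq_trans le_i) //.
rewrite (state_atE _ _ _ w0) // size_tuple (leq_trans _ le_t) //.
exact: leq_trans (leq_addr _ _) le_i.
Qed.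

Lemma regret_against (c : controller S A W) (piL : policy S A W k)
    (w : T.-tuple W) :
  let aL := action piL s0 w in let v := nth w0 w in
  total_reward f r piL s0 w - total_reward f r (against f c piL) s0 w
  = \sum_(0 <= t < T) gain (response c aL v) aL v t
    + tail_reward f r s0 piL (traj f s0 aL v (T - k)) w.
Proof.
rewrite /= regret_gain; congr (_ + _).
apply: eq_big_nat => t /andP[_ lt_t].
rewrite /gain (action_against _ _ _ (ltnW lt_t)).
congr (_ - r _ _ _); apply: eq_traj => i lt_i //.
by apply: action_against; rewrite ltnW // (ltn_trans lt_i).
Qed.

(** Nonanticipation: the benchmark states visible at time [t] have index at most [t - k], hence
    depend only on benchmark actions before [t - k]. *)
Lemma eq_response c aL aL' w w' t :
  (forall i, (i < t - k)%N -> aL i = aL' i) ->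
  (forall i, (i < t)%N -> w i = w' i) ->
  response c aL w t = response c aL' w' t.
Proof.
move=> eq_a eq_w; rewrite /response.
have -> : mkseq w t = mkseq w' t.
  by apply/eq_in_map => i; rewrite mem_iota add0n; apply: eq_w.
congr (c _ _ _ _); apply/eq_in_map => i; rewrite mem_iota add0n => /lt_delay le_i.
apply: eq_traj => l lt_l.
  by apply: eq_a; rewrite ltn_subRL addnC (leq_trans _ le_i) // ltn_add2r.
by apply: eq_w; rewrite (leq_trans lt_l) // (leq_trans (leq_addr _ _) le_i).
Qed.

Lemma eq_track c aL aL' w w' t :
  (forall i, (i < t - k)%N -> aL i = aL' i) ->
  (forall i, (i < t)%N -> w i = w' i) ->
  track (response c aL w) aL w t = track (response c aL' w') aL' w' t.
Proof.
move=> eq_a eq_w; rewrite /track.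
have -> : mkseq w t = mkseq w' t.
  by apply/eq_in_map => i; rewrite mem_iota add0n; apply: eq_w.
congr (_, _, _); apply: eq_traj => i lt_i //.
- apply: eq_response => l lt_l; last exact/eq_w/ltn_trans/lt_i.
  exact/eq_a/(leq_trans lt_l)/leq_sub2r/ltnW.
- exact: eq_w.
- exact: eq_a.
- by apply: eq_w; rewrite (leq_trans lt_i) // leq_subr.
Qed.

(** The selector replays its own past from the data it sees, so the controller state it recomputes
    is the true one. *)
Lemma selector_response aJ aG aL w t :
  response (selector f k aJ aG) aL w t =
  let x := track (response (selector f k aJ aG) aL w) aL w t in
  if (t < k)%N then aG t x.1.1 x.2 else aJ t x.
Proof.
(* The selector reading the full sequences; by [muE] truncated histories give the same action. *)
pose mu i s := if (i < k)%N then aG i s (mkseq w i)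
  else aJ i (s, traj f s0 aL w (i - k), drop (i - k) (mkseq w i)).
have muE i j s : (i <= j)%N ->
    selector_action k aJ aG (mkseq w j) (mkseq (traj f s0 aL w) (j.+1 - k)) i s
    = mu i s.
  move=> le_ij; rewrite /selector_action /mu take_mkseq //.
  case: ltnP => // le_ki.
  by rewrite nth_mkseq // ltn_sub2r ?ltnS // (leq_trans le_ki).
have runE j : response (selector f k aJ aG) aL w j
    = mu j (run f mu 0 s0 (mkseq w j)).
  rewrite /response /= muE //; congr mu.
  apply: eq_run => i s; rewrite add0n size_mkseq => /andP[_ /ltnW lt_i].
  exact: muE.
have trajE j : traj f s0 (response (selector f k aJ aG) aL w) w j
    = run f mu 0 s0 (mkseq w j).
  elim: j => [//|j IH]; rewrite trajS IH runE.
  by rewrite mkseqS run_rcons size_mkseq.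
rewrite runE /track /= trajE /mu; case: ltnP => // lt_t.
have /eqP -> : (t - k == 0)%N by rewrite subn_eq0 ltnW.
by rewrite drop0.
Qed.

(** * Bounds on the regret by the prefix value *)

Definition minimizing (aJ : nat -> tracking -> A) (aG : nat -> S -> seq W -> A) :=
  (forall (t : nat) (x : @tracking S W), (k <= t < T)%N -> size x.2 = k ->
     argmin (backup f r (J f r T k t.+1) x) (aJ t x)) /\
  (forall (t : nat) (s : S) (v : seq W), (t < k)%N -> size v = t ->
     argmin (prefix_backup f r (G f r T k s0 t.+1) s v) (aG t s v)).

(** [value_ge] bounds the gains plus the final value, and that value, [Psi], dominates the actual
    tail reward of the benchmark. *)
Lemma selector_le aJ aG (piL : policy S A W k) (w : T.-tuple W) :
  minimizing aJ aG ->
  total_reward f r piL s0 w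
  - total_reward f r (against f (selector f k aJ aG) piL) s0 w
  <= G f r T k s0 0 s0 [::].
Proof.
move=> [minJ minG]; rewrite regret_against.
set c := selector f k aJ aG; set aL := action piL s0 w; set v := nth w0 w.
rewrite -(value0 (response c aL v) aL v).
apply: le_trans (value_ge _) => [|t lt_t].
  by rewrite lerD2l value_top; apply: (Psi_max s0 w _).2.
rewrite {2}/c selector_response -/c /= /stage_backup.
case: ltnP => [lt_k | le_k].
  by apply: minG => //; rewrite size_track (minn_idPl (ltnW lt_k)).
by apply: minJ; rewrite ?le_k // size_track (minn_idPr le_k).
Qed.

(* Since [c] is deterministic, an adversary that plays a maximizing
   [(w_t, a^L_{t-k})] in every stage can fix its moves in advance. *)
Lemma adversary (c : controller S A W) :
  exists (piL : policy S A W k) (w : T.-tuple W),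
    G f r T k s0 0 s0 [::]
    <= total_reward f r piL s0 w - total_reward f r (against f c piL) s0 w.
Proof.
(* A history [h] lists the pairs chosen so far. The action in pair number [i + k] is the benchmark
   action at time [i], hence the shift in [ha]. *)
pose hw (h : seq (W * A)) i := (nth (w0, a0) h i).1.
pose ha (h : seq (W * A)) i := (nth (w0, a0) h (i + k)).2.
pose hc h := response c (ha h) (hw h).
(* [g] answers each history with a maximizing pair; iterating it from the empty history yields all
   moves. *)
have /choice[g gP] h : exists p, let t := size h in
    let x := track (hc h) (ha h) (hw h) t in
    stage t x (hc h t) p = stage_backup t x (hc h t).
  exact: (stage_backup_max _ _ _).1.
pose hist n := iter n (fun h => rcons h (g h)) [::].
pose p n := g (hist n).
have histE n : hist n = mkseq p n by elim: n => [//|n IH]; rewrite mkseqS -IH.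
pose w := [tuple of mkseq (fun i => (p i).1) T].
pose aP i := (p (i + k)%N).2.
(* The stages fix only the benchmark actions before [T - k]; the last [k] are taken from a policy
   attaining [Psi]. *)
have [[piT PsiT] _] := Psi_max s0 w (traj f s0 aP (nth w0 w) (T - k)).
pose aL i := if (i < T - k)%N then aP i else action piT s0 w i.
exists (open_loop aL), w; rewrite regret_against.
have -> : action (open_loop aL) s0 w = aL by [].
set v := nth w0 w.
have eq_end : traj f s0 aL v (T - k) = traj f s0 aP v (T - k).
  by apply: eq_traj => // i lt_i; rewrite /aL lt_i.
have -> : tail_reward f r s0 (open_loop aL) (traj f s0 aL v (T - k)) w
    = value T (track (response c aL v) aL v T).
  rewrite value_top eq_end -PsiT !tail_rewardE.
  by apply: eq_tail_sum => i /andP[le_i _]; rewrite /action /= /aL ltnNge le_i.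
rewrite -(value0 (response c aL v) aL v); apply: value_le => t lt_t.
(* Before stage [t] the final sequences agree with the history of length [t], so the controller
   action and the tracking state are those [g] replied to. *)
have vE i : (i < t)%N -> v i = hw (hist t) i.
  move=> lt_i; rewrite /v /= /hw histE !nth_mkseq //; exact: ltn_trans lt_t.
have aE i : (i < t - k)%N -> aL i = ha (hist t) i.
  rewrite ltn_subRL addnC => lt_i; rewrite /aL ltn_subRL addnC.
  by rewrite (ltn_trans lt_i lt_t) /ha histE nth_mkseq.
have sz : size (hist t) = t by rewrite histE size_mkseq.
rewrite (eq_track _ aE vE) (eq_response _ aE vE).
have := gP (hist t); rewrite sz /= -/(p t) /hc => <-.
have -> : v t = (p t).1 by rewrite /v /= nth_mkseq.
rewrite /stage; case: ltnP => // le_k.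
by rewrite /aL ltn_sub2rE ?lt_t // /aP subnK.
Qed.

(** * Worst-case and optimal regret *)

Context (Rmax : R) (hr : forall s a w, `|r s a w| <= Rmax).

Lemma norm_total_reward j (pi : policy S A W j) (w : T.-tuple W) :
  `|total_reward f r pi s0 w| <= Rmax *+ T.
Proof.
apply: le_trans (ler_norm_sum _ _ _) _.
rewrite -[X in _ *+ X]card_ord -sumr_const.
by apply: ler_sum => t _; apply: hr.
Qed.

Lemma regret_max (piC : policy S A W 0) (piL : policy S A W k) :
  is_max (fun w : T.-tuple W =>
            total_reward f r piL s0 w - total_reward f r piC s0 w)
         (regret f r T s0 piC piL).
Proof.
by apply: sup_is_max; apply/card_gt0P; exists [tuple of nseq T w0].
Qed.

(** The supremum ranges over all policies, which are not a finite type, so it needs an explicit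
    upper bound: twice the bound [Rmax *+ T] on a total reward. *)
Lemma worst_regret_ge c (piL : policy S A W k) :
  regret f r T s0 (against f c piL) piL <= worst_regret f r T k s0 c.
Proof.
apply: ub_le_sup; last by exists piL.
exists (Rmax *+ T + Rmax *+ T) => _ [piL' _ <-].
have [[w <-] _] := regret_max (against f c piL') piL'.
apply: le_trans (ler_norm _) (le_trans (ler_normB _ _) _).
by apply: lerD; apply: norm_total_reward.
Qed.

Lemma worst_regret_lower c : G f r T k s0 0 s0 [::] <= worst_regret f r T k s0 c.
Proof.
have [piL [w le_w]] := adversary c.
apply: le_trans le_w (le_trans _ (worst_regret_ge c piL)).
exact: (regret_max _ _).2.
Qed.

Lemma worst_regret_selector aJ aG : minimizing aJ aG ->
  worst_regret f r T k s0 (selector f k aJ aG) = G f r T k s0 0 s0 [::].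
Proof.
move=> min_a; apply/eqP; rewrite eq_le worst_regret_lower andbT.
apply: ge_sup => [|_ [piL _ <-]]; first by eexists; exists (open_loop (fun=> a0)).
have [[w <-] _] := regret_max (against f (selector f k aJ aG) piL) piL.
exact: selector_le.
Qed.

(** Provides a selector at which the infimum in [opt_regret] is attained. *)
Lemma minimizing_exists : exists aJ aG, minimizing aJ aG.
Proof.
have /choice[aJ aJP] (tx : nat * @tracking S W) :
    exists a, argmin (backup f r (J f r T k tx.1.+1) tx.2) a.
  have [[a Fa] Fmin] := inf_is_min (backup f r (J f r T k tx.1.+1) tx.2) cardA.
  by exists a => a'; rewrite Fa.
have /choice[aG aGP] (tx : nat * (S * seq W)) :
    exists a, argmin (prefix_backup f r (G f r T k s0 tx.1.+1) tx.2.1 tx.2.2) a.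
  have [[a Fa] Fmin] := inf_is_min
    (prefix_backup f r (G f r T k s0 tx.1.+1) tx.2.1 tx.2.2) cardA.
  by exists a => a'; rewrite Fa.
exists (fun t x => aJ (t, x)), (fun t s v => aG (t, (s, v))).
by split=> [t x _ _ | t s v _ _]; [apply: (aJP (t, x)) | apply: (aGP (t, (s, v)))].
Qed.

Lemma opt_regretE : opt_regret f r T k s0 = G f r T k s0 0 s0 [::].
Proof.
apply: is_min_inf; split; last exact: worst_regret_lower.
have [aJ [aG min_a]] := minimizing_exists.
by exists (selector f k aJ aG); apply: worst_regret_selector.
Qed.

End Game.

Theorem theorem2 (R : realType) (S A W : finType)
    (f : S -> A -> W -> S) (r : S -> A -> W -> R) (Rmax : R)
    (k T : nat) (s0 : S)
    (hA : (0 < #|A|)%N) (hW : (0 < #|W|)%N)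
    (hr : forall s a w, `|r s a w| <= Rmax)
    (hk : (1 <= k)%N) (hT : (k <= T)%N) :
  [/\ (* the dynamic programs are well defined *)
      [/\ forall (s : S) (w : T.-tuple W) (sL : S),
            is_max (fun piL : policy S A W k => tail_reward f r s piL sL w)
                   (Psi f r T k sL (drop (T - k) w)),
          forall x : tracking, size x.2 = k ->
            J f r T k T x = Psi f r T k x.1.2 x.2,
          forall (t : nat) (x : tracking), (k <= t < T)%N -> size x.2 = k ->
            (forall aC : A,
               is_max (fun p : W * A =>
                         rho r x aC p.2 p.1 + J f r T k t.+1 (F f x aC p.2 p.1))
                      (backup f r (J f r T k t.+1) x aC)) /\
            is_min (backup f r (J f r T k t.+1) x) (J f r T k t x),
          forall (s : S) (b : seq W), size b = k ->
            G f r T k s0 k s b = J f r T k k (s, s0, b)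
        & forall (h : nat) (s : S) (v : seq W), (h < k)%N -> size v = h ->
            (forall aC : A,
               is_max (fun w : W =>
                         - r s aC w + G f r T k s0 h.+1 (f s aC w) (rcons v w))
                      (prefix_backup f r (G f r T k s0 h.+1) s v aC)) /\
            is_min (prefix_backup f r (G f r T k s0 h.+1) s v)
                   (G f r T k s0 h s v)],
      (* every minimizing selector is an optimal policy *)
      forall (aJ : nat -> tracking -> A) (aG : nat -> S -> seq W -> A),
        (forall (t : nat) (x : tracking), (k <= t < T)%N -> size x.2 = k ->
           argmin (backup f r (J f r T k t.+1) x) (aJ t x)) ->
        (forall (t : nat) (s : S) (v : seq W), (t < k)%N -> size v = t ->
           argmin (prefix_backup f r (G f r T k s0 t.+1) s v) (aG t s v)) ->
        worst_regret f r T k s0 (selector f k aJ aG) = opt_regret f r T k s0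
    & opt_regret f r T k s0 = G f r T k s0 0 s0 [::]].
Proof.
have /card_gt0P[a0 _] := hA; have /card_gt0P[w0 _] := hW.
split; last exact: opt_regretE.
  split.
  - by move=> s w sL; apply: Psi_max.
  - by move=> x _; apply: J_top.
  - move=> t x /andP[_ lt_t] _; split=> [aC|]; first exact: backup_max.
    by rewrite (JS _ _ _ lt_t); apply: inf_is_min.
  - by move=> s b _; apply: G_top.
  - move=> h s v lt_h _; split=> [aC|]; first exact: prefix_backup_max.
    by rewrite (GS _ _ _ _ lt_h); apply: inf_is_min.
move=> aJ aG minJ minG.
by rewrite (opt_regretE f s0 a0 w0 hk hT hr); apply: worst_regret_selector.
Qed.
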